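(* Let $X$ be a finite set, let $\mathcal{Q}(X)$ be the set of quasigroup structures on $X$, and let $G=\mathrm{Sym}(X)^3$ act on $\mathcal{Q}(X)$ by isotopy. Let $(Q_t)$ be a continuous-time Markov process on $\mathcal{Q}(X)$ with transition rates $r(Q\to R)\ge 0$ such that: (1) $r(g\cdot Q\to g\cdot R)=r(Q\to R)$ for all $g\in G$ and $Q,R\in\mathcal{Q}(X)$; (2) $r(Q\to R)=0$ unless $R\in G\cdot Q^{\#}$; (3) $k([Q]):=\sum_{R\in G\cdot Q^{\#}} r(Q\to R)$ depends only on the isotopy class $[Q]$. If $$k([Q])=k([Q^{\#}])$$ for all isotopy classes $[Q]$, then the induced two-state process on the pair $\{[Q],[Q^{\#}]\}$ satisfies $$\lim_{t\to\infty}\Pr([Q_t]=[Q])=\lim_{t\to\infty}\Pr([Q_t]=[Q^{\#}])=\frac12.$$ In particular, the system converges to a racemic equilibrium.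
   Context: A quasigroup structure on $X$ is a binary operation $\cdot:X\times X\to X$ such that $(X,\cdot)$ is a quasigroup. Isotopy action: for $g=(\alpha,\beta,\gamma)\in G$ and $Q=(X,\cdot)$, $g\cdot Q=(X,\ast)$ with $x\ast y:=\gamma(\alpha^{-1}(x)\cdot\beta^{-1}(y))$. The orbit $G\cdot Q$ is the isotopy class of $Q$, denoted $[Q]$. The mirror of $Q=(X,\cdot)$ is $Q^{\#}:=(X,\diamond)$ with $x\diamond y:=y\cdot x$. The process $(Q_t)$ has generator $(Lf)(Q)=\sum_{R\in\mathcal{Q}(X)} r(Q\to R)(f(R)-f(Q))$. The induced process $[Q_t]$ on $\mathcal{Q}(X)/G$ has generator $(\bar L\bar f)([Q])=k([Q])(\bar f([Q^{\#}])-\bar f([Q]))$ for $\bar f:\mathcal{Q}(X)/G\to\mathbb{R}$, and is regarded as a two-state process on each pair $\{[Q],[Q^{\#}]\}$. ''Racemic equilibrium'' means the distribution giving probability $\tfrac12$ to each of the two states $[Q]$ and $[Q^{\#}]$.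
   Formalization: The formal theorem additionally assumes k([Q])>0 and [Q]≠[Q#] for the pair considered: if all rates are zero the process never moves from its initial state, and if [Q]=[Q#] the probability is always 1, so the limit 1/2 fails. *)

(* Defs.v *)
From HB Require Import structures.
From mathcomp Require Import all_boot all_order all_algebra all_fingroup.
Import Order.TTheory GRing.Theory Num.Theory.

Set Implicit Arguments.
Unset Strict Implicit.
Unset Printing Implicit Defensive.

Local Open Scope ring_scope.

Section Quasigroups.
Variable X : finType.

Definition is_quasigroup (m : {ffun X * X -> X}) : bool :=
  [forall a, forall b, (#|[pred x | m (a, x) == b]| == 1%N)
                    && (#|[pred y | m (y, a) == b]| == 1%N)].

Record quasigroup : predArgType :=
  Quasigroup { qop :> {ffun X * X -> X}; _ : is_quasigroup qop }.

HB.instance Definition _ := [isSub for qop].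
HB.instance Definition _ := [Finite of quasigroup by <:].

Definition isotopism : finGroupType :=
  ({perm X} * {perm X} * {perm X})%type.

Definition isotope_op (Q : quasigroup) (g : isotopism) : {ffun X * X -> X} :=
  let: (al, be, ga) := g in
  [ffun xy => ga (Q ((al^-1)%g xy.1, (be^-1)%g xy.2))].

Lemma isotope_subproof Q g : is_quasigroup (isotope_op Q g).
Proof.
case: Q => m hm /=; case: g => [[al be] ga].
apply/forallP => a; apply/forallP => b.
have /forallP/(_ ((ga^-1)%g b))/andP[/eqP hr _] := forallP hm ((al^-1)%g a).
have /forallP/(_ ((ga^-1)%g b))/andP[_ /eqP hl] := forallP hm ((be^-1)%g a).
have gaE u : (ga u == b) = (u == (ga^-1)%g b).
  by rewrite -(inj_eq (@perm_inj _ (ga^-1)%g)) permK.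
apply/andP; split; apply/eqP.
- rewrite -[RHS]hr -[LHS](card_image (@perm_inj _ (be^-1)%g)).
  apply: eq_card => x; rewrite -[x](permK be) mem_image; last exact: perm_inj.
  by rewrite !inE ffunE gaE.
- rewrite -[RHS]hl -[LHS](card_image (@perm_inj _ (al^-1)%g)).
  apply: eq_card => x; rewrite -[x](permK al) mem_image; last exact: perm_inj.
  by rewrite !inE ffunE gaE.
Qed.

Definition isotope (Q : quasigroup) (g : isotopism) : quasigroup :=
  Quasigroup (isotope_subproof Q g).

Lemma isotope1 Q : isotope Q 1%g = Q.
Proof.
apply/val_inj/ffunP => -[x y].
by rewrite ffunE /= !invg1 !perm1.
Qed.

Lemma isotopeM Q g h : isotope Q (g * h)%g = isotope (isotope Q g) h.
Proof.
case: g => [[a b] c]; case: h => [[a' b'] c'].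
apply/val_inj/ffunP => -[x y].
by rewrite /= ffunE /= !invMg !permM !ffunE /=; congr (_ _); rewrite ffunE.
Qed.

(* [s * t] in [{perm X}] maps [x] to [t (s x)], so the left action of the
   group for ordinary composition is an action in the library's
   (right-handed) sense. *)
Definition isotopy : {action isotopism &-> quasigroup} :=
  TotalAction isotope1 isotopeM.

Definition isotopy_orbit (Q : quasigroup) : {set quasigroup} :=
  orbit isotopy [set: isotopism]%SET Q.

Record isotopy_class : predArgType := IsotopyClass {
  class_set :> {set quasigroup};
  _ : class_set \in [set isotopy_orbit Q | Q in [set: quasigroup]]%SET }.

HB.instance Definition _ := [isSub for class_set].
HB.instance Definition _ := [Finite of isotopy_class by <:].

Definition class_of (Q : quasigroup) : isotopy_class :=
  IsotopyClass (imset_f isotopy_orbit (in_setT Q)).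

Definition mirror_op (Q : quasigroup) : {ffun X * X -> X} :=
  [ffun xy => Q (xy.2, xy.1)].

Lemma mirror_subproof Q : is_quasigroup (mirror_op Q).
Proof.
case: Q => m hm; apply/forallP => a; apply/forallP => b /=.
have /forallP/(_ b)/andP[h1 h2] := forallP hm a.
by apply/andP; split; [rewrite -(eqP h2)|rewrite -(eqP h1)];
  apply/eqP/eq_card => x; rewrite !inE ffunE.
Qed.

Definition mirror (Q : quasigroup) : quasigroup :=
  Quasigroup (mirror_subproof Q).

End Quasigroups.

From mathcomp Require Import all_classical all_reals all_analysis.
Import numFieldNormedType.Exports.

Local Open Scope classical_set_scope.

Section Markov.
Context {R : realType} {S : finType}.

Definition rate_generator (r : S -> S -> R) (f : S -> R) (x : S) : R :=
  \sum_(y : S) r x y * (f y - f x).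

Record transition_semigroup (p : R -> S -> S -> R) : Prop := {
  tsg_ge0 : forall t x y, 0 <= t -> 0 <= p t x y;
  tsg_sum1 : forall t x, 0 <= t -> \sum_(y : S) p t x y = 1;
  tsg_id : forall x y, p 0 x y = (x == y)%:R;
  tsg_mul : forall s t x z, 0 <= s -> 0 <= t ->
    p (s + t) x z = \sum_(y : S) p s x y * p t y z }.

Definition has_generator (p : R -> S -> S -> R)
    (L : (S -> R) -> S -> R) : Prop :=
  forall (f : S -> R) (x : S),
    h^-1 * (\sum_(y : S) p h x y * f y - f x) @[h --> 0^'+] --> L f x.

(* Only times [t >= 0] are constrained. The last clause is the (time
   homogeneous) Markov property with the conditional probabilities
   multiplied out, so that conditioning on null events is harmless. *)
Definition markov_process_with_generator (d : measure_display)
    (Omega : measurableType d) (P : probability Omega R)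
    (Z : R -> Omega -> S) (L : (S -> R) -> S -> R) : Prop :=
  (forall t x, 0 <= t -> measurable [set w | Z t w = x]) /\
  exists p : R -> S -> S -> R,
    [/\ transition_semigroup p,
        has_generator p L &
        forall (past : seq (R * S)) (s h : R) (x y : S),
          0 <= s -> 0 <= h ->
          (forall u, u \in past -> 0 <= u.1 <= s) ->
          let past_event :=
            [set w | forall u, u \in past -> Z u.1 w = u.2] in
          P (past_event `&` [set w | Z s w = x] `&` [set w | Z (s + h) w = y])
          = (P (past_event `&` [set w | Z s w = x]) * (p h x y)%:E)%E].

End Markov.

Definition racemic {R : realType} {X : finType} (Q : quasigroup X)
    (c : isotopy_class X) : R :=
  if (c == class_of Q) || (c == class_of (mirror Q)) then 2^-1 else 0.

(* Main.v *)
Require Import Defs.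
From HB Require Import structures.
From mathcomp Require Import all_boot all_order all_algebra all_fingroup.
From mathcomp Require Import all_classical all_reals all_analysis.
From mathcomp Require Import ring lra.
Import Order.TTheory GRing.Theory Num.Theory.
Import numFieldNormedType.Exports.
Local Open Scope classical_set_scope.
Local Open Scope ring_scope.

Set Implicit Arguments.
Unset Strict Implicit.
Unset Printing Implicit Defensive.

(** The process only jumps from a class to its mirror class, so the functions
    [1_A + 1_B] and [1_A - 1_B], with [A] and [B] the classes of [Q] and of its
    mirror, are eigenfunctions of the generator with eigenvalues [0] and
    [- 2 k A].  An eigenfunction [f] of eigenvalue [c <= 0] satisfies
    [E f(Z_t) = exp(c t) E f(Z_0)], hence [Pr A + Pr B] is constantly [1] while
    [Pr A - Pr B] decays exponentially. *)

Lemma expR_right_derive (R : realType) (c : R) :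
  h^-1 * (expR (c * h) - 1) @[h --> 0^'+] --> c.
Proof.
have [dc dE] : is_derive (0 : R) 1 (fun h => expR (c * h)) c.
  apply: is_derive_eq.
  by rewrite mulr0 expR0 /GRing.scale /= !mulr1 mul1r.
apply: cvg_dnbhs_at_right.
move: dc; rewrite /derivable => /cvg_ex[l hl].
have := hl; move/(cvg_lim (@Rhausdorff _)) => lE.
move: dE hl; rewrite /derive lE => ->.
by under eq_fun do rewrite /= addr0 mulr0 expR0 [_%:A]mulr1.
Qed.

(** The process is constrained only at times [t >= 0], so identities between probabilities hold only
    there; a limit at [+oo] ignores the other times. *)
Lemma cvg_eq_ge0 (R : realType) (T : topologicalType) (f g : R -> T) (l : T) :
  (forall t, 0 <= t -> f t = g t) ->
  f t @[t --> +oo] --> l -> g t @[t --> +oo] --> l.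
Proof.
move=> fg; apply: cvg_trans; apply: near_eq_cvg; near=> t.
by apply: fg; near: t; exact: nbhs_pinfty_ge.
Unshelve. all: by end_near. Qed.

(** * Transition semigroups acting on eigenfunctions of their generator *)

Section Markov.
Context {R : realType} {S : finType}.
Implicit Types (p : R -> S -> S -> R) (f : S -> R).

(** Each row of [p t] is a probability vector, so averaging against it cannot enlarge a uniform
    bound. This keeps earlier errors from growing when they are propagated. *)
Lemma semigroup_contraction p t x f e :
  transition_semigroup p -> 0 <= t -> (forall y, `|f y| <= e) ->
  `|\sum_y p t x y * f y| <= e.
Proof.
move=> [p_ge0 p_sum1 _ _] t0 fe; rewrite (le_trans (ler_norm_sum _ _ _))//.
rewrite -[leRHS]mul1r -(p_sum1 t x t0) mulr_suml ler_sum// => y _.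
by rewrite normrM ger0_norm ?p_ge0// ler_wpM2l ?p_ge0.
Qed.

Lemma semigroup_time0 p x f :
  transition_semigroup p -> \sum_y p 0 x y * f y = f x.
Proof.
move=> pS; rewrite (bigD1 x)//= big1 => [|y /negbTE yx].
  by rewrite (tsg_id pS) eqxx mul1r addr0.
by rewrite (tsg_id pS) eq_sym yx mul0r.
Qed.

(** Both terms equal [f x] at time [0] and have the same right derivative [c * f x] there, so they
    differ by [o(h)]; finiteness of [S] makes this uniform in [x]. *)
Lemma semigroup_short_time p L f c :
  has_generator p L -> (forall x, L f x = c * f x) ->
  forall e : R, 0 < e -> \forall h \near 0^'+, forall x,
    `|\sum_y p h x y * f y - expR (c * h) * f x| <= e * h.
Proof.
move=> genL Lf e e0; apply: filter_forall => x.
have cv : h^-1 * (\sum_y p h x y * f y - expR (c * h) * f x)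
    @[h --> 0^'+] --> L f x - c * f x.
  rewrite (_ : (fun h => _) = fun h =>
      h^-1 * (\sum_y p h x y * f y - f x) - h^-1 * (expR (c * h) - 1) * f x).
    apply: cvgB; first exact: genL.
    by apply: cvgM; [exact: expR_right_derive|exact: cvg_cst].
  by apply/funext => h; ring.
move: cv; rewrite Lf subrr => /cvgr0Pnorm_le/(_ e e0) cv.
near=> h.
have h0 : 0 < h by near: h; exact: nbhs_right_gt.
rewrite -ler_pdivrMr// mulrC.
have -> : h^-1 * `|\sum_y p h x y * f y - expR (c * h) * f x| =
          `|h^-1 * (\sum_y p h x y * f y - expR (c * h) * f x)|.
  by rewrite normrM gtr0_norm ?invr_gt0.
by near: h.
Unshelve. all: by end_near. Qed.

Lemma semigroup_error_mulrn p f c e (h : R) :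
  transition_semigroup p -> c <= 0 -> 0 <= h ->
  (forall x, `|\sum_y p h x y * f y - expR (c * h) * f x| <= e) ->
  forall n x,
    `|\sum_y p (h *+ n) x y * f y - expR (c * (h *+ n)) * f x| <= e *+ n.
Proof.
move=> pS c0 h0 fe; elim=> [|n IH] x.
  by rewrite !mulr0n mulr0 expR0 mul1r semigroup_time0// subrr normr0.
have hn0 : 0 <= h *+ n by rewrite mulrn_wge0.
(* Telescoping: the first summand propagates the error of the first [n] steps through [p h], the
   second is one fresh one-step error, damped by an exponential that is at most [1] because
   [c <= 0]. *)
have -> : \sum_y p (h *+ n.+1) x y * f y - expR (c * (h *+ n.+1)) * f x =
   \sum_z p h x z *
       (\sum_y p (h *+ n) z y * f y - expR (c * (h *+ n)) * f z) +
   expR (c * (h *+ n)) * (\sum_y p h x y * f y - expR (c * h) * f x).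
  rewrite mulrS mulrDr expRD.
  under eq_bigr do rewrite (tsg_mul pS)// mulr_suml.
  rewrite exchange_big/=.
  under [in RHS]eq_bigr do rewrite mulrBr.
  rewrite sumrB mulrBr mulr_sumr.
  have -> : \sum_i p h x i * (expR (c * (h *+ n)) * f i) =
            \sum_i expR (c * (h *+ n)) * (p h x i * f i).
    by apply: eq_bigr => i _; ring.
  have -> : \sum_j \sum_i p h x j * p (h *+ n) j i * f i =
            \sum_i p h x i * (\sum_y p (h *+ n) i y * f y).
    by apply: eq_bigr => i _; rewrite mulr_sumr; apply: eq_bigr => y _; ring.
  by ring.
rewrite mulrSr (le_trans (ler_normD _ _))// lerD//.
  exact: semigroup_contraction.
rewrite normrM ger0_norm ?expR_ge0// (le_trans _ (fe x))//.
by rewrite ler_piMl// -expR0 ler_expR mulr_le0_ge0.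
Qed.

(* The error is [o(h)] at time [h] and at most [n] times as large at time
   [h *+ n], so splitting [t] into [n] steps shows that it vanishes at [t];
   this avoids solving an equation known only for right derivatives. *)
Lemma semigroup_eigenfunction p L f c :
  transition_semigroup p -> has_generator p L -> c <= 0 ->
  (forall x, L f x = c * f x) ->
  forall t x, 0 <= t -> \sum_y p t x y * f y = expR (c * t) * f x.
Proof.
move=> pS genL c0 Lf t x; rewrite le_eqVlt => /predU1P[<-|t0].
  by rewrite mulr0 expR0 mul1r semigroup_time0.
apply/eqP; rewrite -subr_eq0 -normr_le0; apply/ler_addgt0Pl => e e0.
rewrite addr0.
(* With tolerance [e / t] per unit of time, the errors over the whole of [[0, t]] add up to at most
   [e]. *)
have := semigroup_short_time genL Lf (divr_gt0 e0 t0).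
rewrite near_withinE => /nbhs_ballP[dl /= dl0 short].
(* The successor makes [n] positive and strictly larger than [t / dl], so the step [t / n] is
   shorter than [dl]. *)
pose n := (Num.truncn (t / dl)).+1.
have n0 : 0 < n%:R :> R by rewrite ltr0n.
have -> : t = (t / n%:R) *+ n by rewrite -mulr_natr divfK// gt_eqF.
rewrite (le_trans (semigroup_error_mulrn
  (e := e / t * (t / n%:R)) pS c0 _ _ n x))//.
- by rewrite divr_ge0// ltW.
- apply: short; last by rewrite divr_gt0.
  rewrite /ball /= sub0r normrN gtr0_norm ?divr_gt0//.
  by rewrite ltr_pdivrMr// mulrC -ltr_pdivrMr// truncnS_gt.
- by rewrite -[leLHS]mulr_natr mulrA !divfK ?gt_eqF.
Qed.

End Markov.

(** * Laws of random variables with finitely many values *)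

Section Law.
Context {R : realType} {S : finType} {d : measure_display}.
Context {Omega : measurableType d} (P : probability Omega R).

Definition law {T : Type} (Y : Omega -> T) (y : T) : R :=
  fine (P [set w | Y w = y]).

(** The event is a finite disjoint union of fibres of [Y], so additivity applies. *)
Lemma probability_preimage (Y : Omega -> S) (A : pred S) :
  (forall x, measurable [set w | Y w = x]) ->
  P [set w | A (Y w)] = (\sum_(y | A y) law Y y)%:E.
Proof.
move=> mY.
have -> : [set w | A (Y w)] = \bigcup_(y in [set y | A y]) [set w | Y w = y].
  apply/seteqP; split=> [w Aw|w [y /= Ay ->]]//.
  by exists (Y w).
transitivity (\sum_(y \in [set y | A y]) P [set w | Y w = y])%E.
  apply: measure_fin_bigcup; [exact: finite_finset| |by move=> *; exact: mY].
  by move=> i j _ _ [w [/= <- <-]].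
rewrite (fsbigE (enum A)) ?enum_uniq//; last first.
- by move=> y Ay; rewrite mem_enum => /negP.
- by move=> y /=; rewrite mem_enum.
transitivity (\sum_(y | A y) (law Y y)%:E)%E; last exact: sumEFin.
rewrite big_enum_cond/=; apply: eq_big => [y|y _].
  by rewrite andb_idr// => Ay; rewrite inE.
by rewrite /law fineK// fin_num_measure.
Qed.

End Law.

(** * Passage from the semigroup to the process *)

Section MarkovExpectation.
Context {R : realType} {S : finType} {d : measure_display}.
Context {Omega : measurableType d} (P : probability Omega R).

Lemma law_marginal (Y1 Y2 : Omega -> S) (y : S) :
  (forall x, measurable [set w | Y1 w = x]) ->
  (forall x, measurable [set w | Y2 w = x]) ->
  law P Y2 y = \sum_x fine (P ([set w | Y1 w = x] `&` [set w | Y2 w = y])).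
Proof.
move=> mY1 mY2.
have pairE x z : [set w | (Y1 w, Y2 w) = (x, z)] =
    [set w | Y1 w = x] `&` [set w | Y2 w = z].
  by apply/seteqP; split=> w /= [-> ->].
have mY (xz : S * S) : measurable [set w | (Y1 w, Y2 w) = xz].
  by case: xz => x z; rewrite pairE; apply: measurableI.
(* The pair is treated as a single [S * S]-valued variable, so that [probability_preimage] sums over
   its first coordinate. *)
transitivity (fine (P [set w | (Y1 w, Y2 w).2 == y])).
  by congr (fine (P _)); apply/seteqP; split=> w /= /eqP.
rewrite (probability_preimage P (Y := fun w => (Y1 w, Y2 w))
           (fun xz => xz.2 == y) mY)/=.
rewrite [RHS](eq_bigr (fun x => \sum_(z | z == y)
    law P (fun w => (Y1 w, Y2 w)) (x, z))); last first.
  by move=> x _; rewrite big_pred1_eq /law pairE.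
by rewrite pair_big_dep/=; apply: eq_bigr => -[].
Qed.

(** The law at time [t] is the initial law multiplied by [p t], and [p t] scales [f] by the
    exponential. *)
Lemma markov_process_eigenfunction (Z : R -> Omega -> S) L (f : S -> R) c :
  markov_process_with_generator P Z L -> c <= 0 ->
  (forall x, L f x = c * f x) -> forall t, 0 <= t ->
  \sum_y law P (Z t) y * f y = expR (c * t) * \sum_x law P (Z 0) x * f x.
Proof.
move=> [mZ [p [pS genL markov]]] c0 Lf t t0.
have lawE y : law P (Z t) y = \sum_x law P (Z 0) x * p t x y.
  rewrite (@law_marginal (Z 0)); [|by move=> z; exact: mZ..].
  apply: eq_bigr => x _.
  (* With an empty list of past observations the past event is the whole space. *)
  have := markov [::] 0 t x y (lexx 0) t0; rewrite /= add0r.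
  rewrite (_ : mkset _ = setT); last by apply/seteqP; split.
  rewrite !setTI => -> //.
  by rewrite fineM// fin_num_measure//; exact: mZ.
under eq_bigr do rewrite lawE mulr_suml.
rewrite exchange_big mulr_sumr/=; apply: eq_bigr => x _.
rewrite mulrCA -(semigroup_eigenfunction pS genL c0 Lf x t0) mulr_sumr.
by apply: eq_bigr => y _; rewrite mulrA.
Qed.

End MarkovExpectation.

(** * Mirrors and isotopy classes *)

Lemma class_of_mirror (X : finType) (Q1 Q2 : quasigroup X) :
  class_of Q1 = class_of Q2 -> class_of (mirror Q1) = class_of (mirror Q2).
Proof.
move=> /(congr1 val)/= /orbit_eqP/orbitP[[[al be] ga] _ <-].
(* Mirroring swaps the two arguments, hence the permutations acting on them. *)
apply/val_inj/orbit_eqP/orbitP; exists (be, al, ga) => //.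
by apply/val_inj/ffunP => -[x y]; rewrite /= !ffunE.
Qed.

Lemma mirrorK (X : finType) : involutive (@mirror X).
Proof. by move=> Q; apply/val_inj/ffunP => -[x y]; rewrite /= !ffunE. Qed.

Lemma mem_isotopy_orbit (X : finType) (Q1 Q2 : quasigroup X) :
  (Q1 \in isotopy_orbit Q2) = (class_of Q1 == class_of Q2).
Proof.
by apply/orbit_eqP/eqP => [?|/(congr1 val)//]; exact: val_inj.
Qed.

(** This is the induced generator on classes: every jump of nonzero rate lands in the mirror class,
    where [F] composed with [class_of] is constant, so the rates sum to [k]. *)
Lemma rate_generator_class (R : realType) (X : finType)
    (r : quasigroup X -> quasigroup X -> R) (k : isotopy_class X -> R)
    (F : isotopy_class X -> R) (Q : quasigroup X) :
  (forall Q1 Q2, Q2 \notin isotopy_orbit (mirror Q1) -> r Q1 Q2 = 0) ->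
  (forall Q1,
    k (class_of Q1) = \sum_(Q2 in isotopy_orbit (mirror Q1)) r Q1 Q2) ->
  rate_generator r (F \o @class_of X) Q =
  k (class_of Q) * (F (class_of (mirror Q)) - F (class_of Q)).
Proof.
move=> r_support kE; rewrite kE mulr_suml /rate_generator
  (bigID (mem (isotopy_orbit (mirror Q))))/=.
rewrite [X in _ + X]big1 => [|Q' /r_support ->]; last by rewrite mul0r.
rewrite addr0; apply: eq_bigr => Q'.
by rewrite mem_isotopy_orbit => /eqP ->.
Qed.

Theorem corollary2p7
  (R : realType) (X : finType)
  (r : quasigroup X -> quasigroup X -> R)
  (k : isotopy_class X -> R)
  (d : measure_display) (Omega : measurableType d) (P : probability Omega R)
  (Z : R -> Omega -> quasigroup X)
  (r_ge0 : forall Q Q' : quasigroup X, 0 <= r Q Q')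
  (r_equivariant : forall (g : isotopism X) (Q Q' : quasigroup X),
     r (isotopy X Q g) (isotopy X Q' g) = r Q Q')
  (r_support : forall Q Q' : quasigroup X,
     Q' \notin isotopy_orbit (mirror Q) -> r Q Q' = 0)
  (kE : forall Q : quasigroup X,
     k (class_of Q) = \sum_(Q' in isotopy_orbit (mirror Q)) r Q Q')
  (Z_markov : markov_process_with_generator P Z (rate_generator r))
  (k_mirror : forall Q : quasigroup X,
     k (class_of Q) = k (class_of (mirror Q)))
  (Q : quasigroup X)
  (Q_chiral : class_of Q <> class_of (mirror Q))
  (k_gt0 : 0 < k (class_of Q))
  (Z_start : P [set w | class_of (Z 0 w) = class_of Q \/
                        class_of (Z 0 w) = class_of (mirror Q)] = 1%E) :
  [/\ P [set w | class_of (Z t w) = class_of Q] @[t --> +oo]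
        --> (2^-1 : R)%:E,
      P [set w | class_of (Z t w) = class_of (mirror Q)] @[t --> +oo]
        --> (2^-1 : R)%:E &
      forall c : isotopy_class X,
        P [set w | class_of (Z t w) = c] @[t --> +oo]
          --> (racemic Q c : R)%:E].
Proof.
have Z_meas : forall t x, 0 <= t -> measurable [set w | Z t w = x].
  by case: Z_markov.
set A := class_of Q in Q_chiral k_gt0 Z_start *.
set B := class_of (mirror Q) in Q_chiral Z_start *.
have AB : (A == B) = false by apply/eqP.
have mirrorAB x : (class_of (mirror x) == B) = (class_of x == A).
  apply/eqP/eqP => [/class_of_mirror|]; last exact: class_of_mirror.
  by rewrite !mirrorK.
have mirrorBA x : (class_of (mirror x) == A) = (class_of x == B).
  by rewrite -mirrorAB mirrorK.
(* Written as the expectation of an indicator, the form that [markov_process_eigenfunction]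
   handles. *)
pose prob t c : R := \sum_x law P (Z t) x * (class_of x == c)%:R.
have probE t c : 0 <= t -> P [set w | class_of (Z t w) = c] = (prob t c)%:E.
  move=> t0; rewrite (_ : mkset _ = [set w | class_of (Z t w) == c]).
    rewrite (probability_preimage P (fun x => class_of x == c)).
      rewrite /prob big_mkcond/=; congr EFin; apply: eq_bigr => x _.
      by case: eqP; rewrite ?mulr1 ?mulr0.
    by move=> x; exact: Z_meas.
  by apply/seteqP; split=> w /= /eqP.
have sumAB0 : prob 0 A + prob 0 B = 1.
  apply: EFin_inj; rewrite -Z_start.
  pose inAB x := (class_of x == A) || (class_of x == B).
  rewrite (_ : mkset _ = [set w | inAB (Z 0 w)]).
    rewrite (probability_preimage P inAB).
      rewrite -big_split [in RHS]big_mkcond /inAB /=.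
      congr EFin; apply: eq_bigr => x _.
      rewrite -mulrDr; case: eqP => [->|_]; first by rewrite AB addr0 mulr1.
      by case: eqP => _; rewrite add0r ?mulr1 ?mulr0.
    by move=> x; exact: Z_meas.
  rewrite /inAB; apply/seteqP; split=> w /=.
    by case=> ->; rewrite eqxx ?orbT.
  by case/orP => /eqP; [left|right].
have sumAB t : 0 <= t -> prob t A + prob t B = 1.
  move=> t0; rewrite -sumAB0 -!big_split/=.
  under eq_bigr do rewrite -mulrDr.
  under [RHS]eq_bigr do rewrite -mulrDr.
  rewrite (markov_process_eigenfunction (c := 0) Z_markov)//.
    by rewrite mul0r expR0 mul1r.
  move=> x; rewrite (rate_generator_class
    (fun c => (c == A)%:R + (c == B)%:R) _ r_support kE) mirrorAB mirrorBA.
  by rewrite [X in _ * (X - _)]addrC subrr mulr0 mul0r.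
have diffAB t : 0 <= t ->
    prob t A - prob t B = expR (- (2 * k A * t)) * (prob 0 A - prob 0 B).
  move=> t0; rewrite -!sumrB.
  under eq_bigr do rewrite -mulrBr.
  under [in RHS]eq_bigr do rewrite -mulrBr.
  rewrite -mulNr.
  apply: (markov_process_eigenfunction Z_markov) => // [|x].
    by rewrite oppr_le0 mulr_ge0// ltW.
  rewrite (rate_generator_class
    (fun c => (c == A)%:R - (c == B)%:R) _ r_support kE) mirrorAB mirrorBA.
  (* The indicator difference is [1] on [A], [-1] on [B] and [0] elsewhere, and mirroring flips its
     sign. The rate on [B] is [k B], and [k_mirror] turns it into [k A], giving one eigenvalue for
     both classes. *)
  case: (class_of x =P A) => [->|_]; first by rewrite AB; ring.
  case: (class_of x =P B) => [->|_]; last by ring.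
  by rewrite -[k B](k_mirror Q) -/A; ring.
(* Positivity of [k A] enters here: the exponent must tend to minus infinity. *)
have decay : expR (- (2 * k A * t)) @[t --> +oo] --> (0 : R).
  have : 2 * k A * t @[t --> +oo] --> +oo.
    by apply: (gt0_cvgMry (f := id)) => //; rewrite mulr_gt0.
  move=> lin; have := @cvgr_expR R.
  by apply: (@cvg_comp _ _ _ _ (fun x => expR (- x))).
have diff0 : prob t A - prob t B @[t --> +oo] --> (0 : R).
  suff : expR (- (2 * k A * t)) * (prob 0 A - prob 0 B) @[t --> +oo]
      --> (0 : R).
    apply: cvg_eq_ge0 => t t0.
    by rewrite (diffAB t).
  rewrite -[X in _ --> X](mul0r (prob 0 A - prob 0 B)).
  by apply: cvgM => //; exact: cvg_cst.
have limA : prob t A @[t --> +oo] --> (2^-1 : R).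
  have : 2^-1 * (1 + (prob t A - prob t B)) @[t --> +oo] --> 2^-1 * (1 + 0 : R).
    by apply: cvgM; [exact: cvg_cst|apply: cvgD => //; exact: cvg_cst].
  rewrite addr0 mulr1; apply: cvg_eq_ge0 => t t0.
  by have := sumAB _ t0; lra.
have limB : prob t B @[t --> +oo] --> (2^-1 : R).
  have : 1 - prob t A @[t --> +oo] --> (1 - 2^-1 : R).
    by apply: cvgB => //; exact: cvg_cst.
  rewrite (_ : 1 - 2^-1 = 2^-1 :> R); last by field.
  apply: cvg_eq_ge0 => t t0.
  by have := sumAB _ t0; lra.
(* Distinct classes are disjoint events and [A] and [B] already carry total mass [1], so nothing is
   left for [c]. *)
have other t c : 0 <= t -> c != A -> c != B -> prob t c = 0.
  move=> t0 /negbTE cA /negbTE cB.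
  have law_ge0 x : 0 <= law P (Z t) x by rewrite /law fine_ge0.
  apply/eqP; rewrite eq_le; apply/andP; split; last first.
    by apply: sumr_ge0 => x _; rewrite mulr_ge0.
  rewrite -(lerD2r (prob t A + prob t B)) add0r [leRHS]sumAB//.
  have <- : \sum_x law P (Z t) x = 1.
    apply: EFin_inj; rewrite -(probability_preimage P xpredT); last first.
      by move=> x; exact: Z_meas.
    by rewrite (_ : mkset _ = setT) ?probability_setT//; apply/seteqP; split.
  rewrite -!big_split/=; apply: ler_sum => x _.
  rewrite -!mulrDr ler_piMr//.
  case: eqP => [->|_]; first by rewrite cA cB !addr0.
  by case: eqP => [->|_]; [rewrite AB add0r addr0|case: eqP; rewrite !add0r].
have lim c l : prob t c @[t --> +oo] --> l ->
    P [set w | class_of (Z t w) = c] @[t --> +oo] --> l%:E.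
  move=> cl; have : (prob t c)%:E @[t --> +oo] --> l%:E.
    by apply: cvg_EFin => //; exact: nearW.
  apply: cvg_eq_ge0 => t t0.
  by rewrite probE.
split; [exact: lim|exact: lim|move=> c; apply: lim; rewrite /racemic].
case: eqVneq => [->//|cA]; case: eqVneq => [->//|cB] /=.
apply: (cvg_eq_ge0 (f := fun=> 0)); last exact: cvg_cst.
by move=> t t0; rewrite other.
Qed.
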